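(* Let $\theta_1,\theta_2\in(0,\pi/2)$ and let $A\in\mathcal{M}_n$ satisfy $$W(A)\subseteq\{re^{-i\theta} : r>0,\ \theta_1\leq\theta\leq\theta_2\}.$$ Then $$w(A)\ \geq\ \frac{\csc\gamma_1}{2}\|A\|+\frac{\csc\gamma_1}{2}\Big|\,\|\Im(A)\|-\|\Re(A)\|\,\Big|,$$ where $\gamma_1=\max\{\theta_2,\pi/2-\theta_1\}$.
   Context: $\mathcal{M}_n$ is the algebra of $n\times n$ complex matrices and $\|\cdot\|$ is the operator norm on $\mathcal{M}_n$ induced by the Euclidean norm on $\mathbb{C}^n$. For $A\in\mathcal{M}_n$: the numerical range is $W(A)=\{\langle Ax,x\rangle : x\in\mathbb{C}^n,\ \|x\|=1\}$ and the numerical radius is $w(A)=\sup\{|\langle Ax,x\rangle| : x\in\mathbb{C}^n,\ \|x\|=1\}$. The Cartesian parts are $\Re(A)=\frac{A+A^*}{2}$ and $\Im(A)=\frac{A-A^*}{2i}$. *)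

(* Defs.v *)
From HB Require Import structures.
From mathcomp Require Import all_boot all_order all_algebra.
From mathcomp Require Import spectral.
From mathcomp Require Import all_classical all_reals all_analysis.
From mathcomp Require Import complex.

Set Implicit Arguments.
Unset Strict Implicit.
Unset Printing Implicit Defensive.

Import Order.TTheory GRing.Theory Num.Theory.

Local Open Scope classical_set_scope.
Local Open Scope sesquilinear_scope.
Local Open Scope complex_scope.
Local Open Scope ring_scope.

(* The complex numbers are [R[i]] for a [realType] R.  The library norm [`|z|]
   on [R[i]] is itself complex-valued; [cmod] is the modulus as an element
   of R. *)
Definition cmod (R : realType) (z : R[i]) : R := ComplexField.Normc.normc z.

(* [dotmx] is stated for row vectors, is linear in its first argument and
   conjugate-linear in the second one. *)
Definition inner (R : realType) (n : nat) (x y : 'cV[R[i]]_n) : R[i] :=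
  dotmx x^T y^T.

Definition enorm (R : realType) (n : nat) (x : 'cV[R[i]]_n) : R :=
  Num.sqrt (\sum_(k < n) cmod (x k 0) ^+ 2).

(* For n > 0 the real suprema below are over nonempty bounded sets. *)
Definition opnorm (R : realType) (n : nat) (A : 'M[R[i]]_n) : R :=
  sup [set enorm (A *m x) | x in [set x : 'cV[R[i]]_n | enorm x = 1]].

Definition numrange (R : realType) (n : nat) (A : 'M[R[i]]_n) : set R[i] :=
  [set inner (A *m x) x | x in [set x : 'cV[R[i]]_n | enorm x = 1]].

Definition numradius (R : realType) (n : nat) (A : 'M[R[i]]_n) : R :=
  sup [set cmod (inner (A *m x) x) |
        x in [set x : 'cV[R[i]]_n | enorm x = 1]].

Definition re_part (R : realType) (n : nat) (A : 'M[R[i]]_n) : 'M[R[i]]_n :=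
  2^-1 *: (A + A ^t*).

Definition im_part (R : realType) (n : nat) (A : 'M[R[i]]_n) : 'M[R[i]]_n :=
  (2 * 'i)^-1 *: (A - A ^t*).

(* exp(i t) by Euler's formula *)
Definition cexpi (R : realType) (t : R) : R[i] := cos t +i* sin t.

Definition csc (R : realType) (t : R) : R := (sin t)^-1.

(* Main.v *)
(* Write A = H + iK with H, K hermitian.  Since ||A|| <= ||H|| + ||K||, the
   quantity ||A|| + | ||K|| - ||H|| | is at most 2 max(||H||, ||K||).  A point
   <Ax, x> = r e^(-i theta) of the numerical range has r <= w(A), so
   |<Hx, x>| = r cos theta <= w(A) cos theta1 and
   |<Kx, x>| = r sin theta <= w(A) sin theta2; both are at most
   w(A) sin gamma1.  The norm of a hermitian matrix being its numerical radius,
   ||H|| and ||K|| are at most w(A) sin gamma1. *)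

Require Import Defs.
From mathcomp Require Import all_boot all_order all_algebra.
From mathcomp Require Import spectral.
From mathcomp Require Import all_classical all_reals all_analysis.
From mathcomp Require Import complex.
From mathcomp Require Import lra.

Import Order.TTheory GRing.Theory Num.Theory.

Local Open Scope classical_set_scope.
Local Open Scope sesquilinear_scope.
Local Open Scope complex_scope.
Local Open Scope ring_scope.

Local Notation Re := complex.Re.
Local Notation Im := complex.Im.

(** * The inner product and the Euclidean norm *)

Section InnerProduct.
Variables (R : realType) (n : nat).
Implicit Types (x y z : 'cV[R[i]]_n) (A H : 'M[R[i]]_n).

(** Bridge between the complex-valued library norm and the real-valued [cmod]: library facts on the
    former are carried over to the latter through it. *)
Lemma normc_cmod (a : R[i]) : `|a| = (cmod a)%:C.
Proof. by []. Qed.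

Lemma Re_le_cmod (a : R[i]) : Re a <= cmod a.
Proof. by rewrite -lecR -normc_cmod (le_trans _ (normc_ge_Re a)) // lecR ler_norm. Qed.

Lemma Re_conj (a : R[i]) : Re (a^*) = Re a.
Proof. by case: a. Qed.

Lemma innerE x y : inner x y = \sum_k x k 0 * (y k 0)^*.
Proof. by rewrite /inner dotmxE mxE; apply: eq_bigr => k _; rewrite !mxE. Qed.

Lemma innerC x y : inner y x = (inner x y)^*.
Proof.
rewrite !innerE rmorph_sum; apply: eq_bigr => k _.
by rewrite rmorphM /= conjCK mulrC.
Qed.

Lemma innerDl x y z : inner (x + y) z = inner x z + inner y z.
Proof.
by rewrite !innerE -big_split; apply: eq_bigr => k _; rewrite mxE mulrDl.
Qed.

Lemma innerZl a x z : inner (a *: x) z = a * inner x z.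
Proof.
by rewrite !innerE mulr_sumr; apply: eq_bigr => k _; rewrite mxE mulrA.
Qed.

Lemma inner_adj A x y : inner (A ^t* *m x) y = inner x (A *m y).
Proof.
rewrite /inner !dotmxE !trmx_mul !map_mxM /= !mulmxA.
suff -> : (A ^t*)^T = A^T ^t* by [].
by apply/matrixP => i j; rewrite !mxE.
Qed.

Lemma innerxx x : inner x x = (enorm x ^+ 2)%:C.
Proof.
rewrite sqr_sqrtr ?sumr_ge0// => [|k _]; last exact: sqr_ge0.
rewrite innerE rmorph_sum; apply: eq_bigr => k _.
by rewrite -sqr_normc normc_cmod rmorphXn.
Qed.

Lemma enorm_ge0 x : 0 <= enorm x.
Proof. exact: sqrtr_ge0. Qed.

Lemma cmod_ge0 (a : R[i]) : 0 <= cmod a.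
Proof. by case: a => u v; exact: sqrtr_ge0. Qed.

Lemma enorm_eq0 x : enorm x = 0 -> x = 0.
Proof.
move=> x0; apply: trmx_inj; rewrite trmx0; apply/eqP.
rewrite -(dnorm_eq0 (@dotmx R[i] n)); apply/eqP.
by apply: etrans (innerxx x) _; rewrite x0 expr0n.
Qed.

Lemma enormZ a x : enorm (a *: x) = cmod a * enorm x.
Proof.
apply: (@pexpIrn _ 2); rewrite ?nnegrE ?mulr_ge0 ?enorm_ge0 ?cmod_ge0 //.
apply: complexI; rewrite -innerxx innerZl innerC innerZl innerxx.
have conjR (r : R) : (r%:C)^* = r%:C := conjc_real r.
rewrite rmorphM /= conjR mulrA -normCK normc_cmod.
by rewrite -rmorphXn -rmorphM exprMn.
Qed.

Lemma cmod_inner_le x y : cmod (inner x y) <= enorm x * enorm y.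
Proof.
have : `|inner x y| ^+ 2 <= inner x x * inner y y :=
  (CauchySchwarz (@dotmx R[i] n) x^T y^T).1.
rewrite !innerxx normc_cmod.
rewrite -rmorphXn -rmorphM lecR -exprMn.
by rewrite ler_pXn2r ?nnegrE ?mulr_ge0 ?enorm_ge0 ?cmod_ge0.
Qed.

(** The real inner product of the underlying space of real dimension 2n. It is symmetric and takes
    values in the ordered field [R], so norm identities reduce to linear arithmetic. *)
Definition rinner x y : R := Re (inner x y).

Lemma rinnerC x y : rinner y x = rinner x y.
Proof. by rewrite /rinner innerC Re_conj. Qed.

Lemma rinnerDl x y z : rinner (x + y) z = rinner x z + rinner y z.
Proof. by rewrite /rinner innerDl raddfD. Qed.

Lemma rinnerZl (a : R) x y : rinner (a%:C *: x) y = a * rinner x y.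
Proof. by rewrite /rinner innerZl; case: (inner x y) => u v; simpc. Qed.

Lemma rinnerNl x y : rinner (- x) y = - rinner x y.
Proof. by rewrite -scaleN1r -(rmorphN1 (real_complex R)) rinnerZl mulN1r. Qed.

Lemma rinnerDr x y z : rinner x (y + z) = rinner x y + rinner x z.
Proof. by rewrite !(rinnerC _ x) rinnerDl. Qed.

Lemma rinnerNr x y : rinner x (- y) = - rinner x y.
Proof. by rewrite !(rinnerC _ x) rinnerNl. Qed.

Lemma rinnerZr (a : R) x y : rinner x (a%:C *: y) = a * rinner x y.
Proof. by rewrite !(rinnerC _ x) rinnerZl. Qed.

Lemma rinnerxx x : rinner x x = enorm x ^+ 2.
Proof. by rewrite /rinner innerxx. Qed.

Lemma enormD x y : enorm (x + y) <= enorm x + enorm y.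
Proof.
rewrite -(@ler_pXn2r _ 2) ?nnegrE ?addr_ge0 ?enorm_ge0 //.
have xy : rinner x y <= enorm x * enorm y :=
  le_trans (Re_le_cmod _) (cmod_inner_le x y).
rewrite -rinnerxx rinnerDl !rinnerDr (rinnerC x y) !rinnerxx sqrrD; lra.
Qed.

Lemma normalize_enorm x : x != 0 -> enorm ((enorm x)^-1%:C *: x) = 1.
Proof.
move=> xN0; have nx : enorm x != 0.
  by apply: contra xN0 => /eqP/enorm_eq0 ->.
rewrite enormZ -[cmod _]/(Re (cmod _)%:C) -normc_cmod normc_def /=.
by rewrite expr0n addr0 sqrtr_sqr ger0_norm ?invr_ge0 ?enorm_ge0 // mulVf.
Qed.

Lemma exists_unit : (0 < n)%N -> exists x : 'cV[R[i]]_n, enorm x = 1.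
Proof.
move=> n0; exists ((enorm (const_mx 1 : 'cV[R[i]]_n))^-1%:C *: const_mx 1).
apply: normalize_enorm; apply/eqP => /matrixP/(_ (Ordinal n0) 0).
by rewrite !mxE => /eqP; rewrite oner_eq0.
Qed.

Lemma enorm0 : enorm (0 : 'cV[R[i]]_n) = 0.
Proof. by rewrite -(scale0r 0) enormZ /cmod ComplexField.Normc.normc0 mul0r. Qed.

(* Polarization: [4 Re <Hx, y> = <H(x+y), x+y> - <H(x-y), x-y>], applied to
   [y = Hx / |Hx|] and combined with the parallelogram law. *)
Lemma hermitian_enorm_le H (M : R) : H ^t* = H ->
  (forall x, enorm x = 1 -> `|rinner (H *m x) x| <= M) ->
  forall x, enorm x = 1 -> enorm (H *m x) <= M.
Proof.
move=> hermH boundH x x1.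
(* The bound on unit vectors is made homogeneous, since the vectors [x + y] and [x - y] used below
   need not have norm 1. *)
have quad z : `|rinner (H *m z) z| <= M * enorm z ^+ 2.
  have [->|zN0] := eqVneq z 0.
    by rewrite mulmx0 rinnerxx enorm0 expr0n normr0 mulr0.
  have nz : 0 < enorm z.
    rewrite lt_def enorm_ge0 andbT; apply: contra zN0.
    by move=> /eqP/enorm_eq0 ->.
  have := boundH _ (normalize_enorm _ zN0).
  rewrite -scalemxAr rinnerZl rinnerZr mulrA normrM.
  rewrite -expr2 exprVn ger0_norm ?invr_ge0 ?sqr_ge0 // mulrC.
  by rewrite ler_pdivrMr // exprn_gt0.
have [Hx0|HxN0] := eqVneq (H *m x) 0.
  by rewrite Hx0 enorm0 (le_trans _ (boundH x x1)).
have := normalize_enorm _ HxN0; set y := _ *: _ => y1.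
have HxyE : rinner (H *m x) y = enorm (H *m x).
  rewrite rinnerZr rinnerxx expr2 mulKf //.
  by apply: contra HxN0 => /eqP/enorm_eq0 ->.
have HyxE : rinner (H *m y) x = enorm (H *m x).
  by rewrite -HxyE rinnerC /rinner -inner_adj hermH.
have := quad (x + y); have := quad (x - y).
(* Only the lower bound at [x - y] and the upper bound at [x + y] are kept. In their difference the
   diagonal terms and [rinner x y] cancel, leaving 4 |Hx| <= 4 M. *)
rewrite -!rinnerxx !mulmxDr !mulmxN !(rinnerDl, rinnerDr, rinnerNl, rinnerNr).
rewrite HxyE HyxE (rinnerC y x) !rinnerxx x1 y1 !ler_norml => /andP[+ _] /andP[_ +].
move: (enorm _) (rinner x y) (rinner _ x) (rinner _ y) => N c a b; clear; lra.
Qed.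

(** * Cartesian parts *)

Lemma hermitian_re_part A : (re_part A) ^t* = re_part A.
Proof.
apply/matrixP => i j; rewrite !mxE rmorphM rmorphD /= conjCK fmorphV.
by rewrite rmorph_nat addrC.
Qed.

Lemma hermitian_im_part A : (im_part A) ^t* = im_part A.
Proof.
apply/matrixP => i j; rewrite !mxE rmorphM rmorphB /= conjCK fmorphV rmorphM.
by rewrite rmorph_nat /= conjCi mulrN invrN mulNr -mulrN opprB.
Qed.

Lemma two_i_neq0 : 2 * 'i != 0 :> R[i].
Proof. by rewrite mulf_neq0 ?neq0Ci ?pnatr_eq0. Qed.

Lemma cartesian_parts A : A = re_part A + 'i *: im_part A.
Proof.
rewrite /re_part /im_part scalerA invfM mulrCA divff ?neq0Ci // mulr1.
by rewrite -scalerDr addrACA subrr addr0 -mulr2n -(scaler_nat _ A) scalerA mulVf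
  ?scale1r ?pnatr_eq0.
Qed.

Lemma rinner_re_part A x : rinner (re_part A *m x) x = Re (inner (A *m x) x).
Proof.
rewrite /rinner -scalemxAl mulmxDl innerZl innerDl inner_adj (innerC (A *m x)).
have -> : (2^-1 : R[i]) = (2^-1)%:C by rewrite fmorphV rmorph_nat.
by case: (inner _ _) => a b; simpc => /=; lra.
Qed.

Lemma rinner_im_part A x : rinner (im_part A *m x) x = Im (inner (A *m x) x).
Proof.
rewrite /rinner -scalemxAl mulmxBl innerZl -scaleN1r innerDl innerZl inner_adj.
rewrite (innerC (A *m x)); set z := inner _ _.
suff -> : (2 * 'i)^-1 * (z + -1 * z^*) = (Im z)%:C by [].
(* Clearing the denominator leaves z - conj z = 2i Im z. *)
apply: (mulfI two_i_neq0); rewrite mulVKf ?two_i_neq0 // -complexiE.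
by case: z => a b; apply/eqP; rewrite eq_complex; simpc => /=; apply/eqP; lra.
Qed.

(** * Boundedness, and estimates on the suprema *)

Lemma bounded_numrange A : exists M : R, forall x, enorm x = 1 ->
  cmod (inner (A *m x) x) <= M.
Proof.
(* A crude bound suffices, as it only serves to make [sup] an upper bound: each coordinate of a unit
   vector has modulus at most 1, so <Ax, x> is bounded by the sum of the moduli of the entries. *)
exists (\sum_k \sum_j cmod (A k j)) => x x1.
have coord k : `|x k 0| <= 1.
  rewrite normc_cmod lecR -(@ler_pXn2r _ 2) ?nnegrE ?cmod_ge0 //.
  rewrite expr1n -(expr1n _ 2) -x1 sqr_sqrtr ?sumr_ge0 // => [|i _]; last exact: sqr_ge0.
  by rewrite (bigD1 k) //= lerDl sumr_ge0 // => i _; exact: sqr_ge0.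
rewrite -lecR -normc_cmod innerE rmorph_sum; apply: le_trans (ler_norm_sum _ _ _) _.
apply: ler_sum => k _; rewrite normrM norm_conjC mxE rmorph_sum.
apply: le_trans (ler_piMr _ (coord k)) _ => //.
apply: le_trans (ler_norm_sum _ _ _) _; apply: ler_sum => j _.
by rewrite normrM; exact: ler_piMr (normr_ge0 _) (coord j).
Qed.

Lemma cmod_inner_le_numradius A x : enorm x = 1 ->
  cmod (inner (A *m x) x) <= numradius A.
Proof.
move=> x1; have [M boundM] := bounded_numrange A.
apply: ub_le_sup; last by exists x.
by exists M => _ [y y1 <-]; exact: boundM.
Qed.

(** Positive dimension provides a unit vector, so that the supremum is over a nonempty set. *)
Lemma opnorm_le A (M : R) : (0 < n)%N ->
  (forall x, enorm x = 1 -> enorm (A *m x) <= M) -> opnorm A <= M.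
Proof.
move=> n_gt0 boundM; apply: ge_sup; last by move=> _ [x x1 <-]; exact: boundM.
by have [x x1] := exists_unit n_gt0; exists (enorm (A *m x)), x.
Qed.

Lemma enorm_le_opnorm A (M : R) x :
  (forall x, enorm x = 1 -> enorm (A *m x) <= M) ->
  enorm x = 1 -> enorm (A *m x) <= opnorm A.
Proof.
move=> boundM x1; apply: ub_le_sup; last by exists x.
by exists M => _ [y y1 <-]; exact: boundM.
Qed.

Lemma hermitian_opnorm_le H (M : R) : (0 < n)%N -> H ^t* = H ->
  (forall x, enorm x = 1 -> `|rinner (H *m x) x| <= M) -> opnorm H <= M.
Proof. by move=> n_gt0 hermH boundH; apply/opnorm_le/hermitian_enorm_le. Qed.

(** For hermitian matrices, boundedness on the unit sphere comes from that of the numerical range by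
    [hermitian_enorm_le]. *)
Lemma bounded_hermitian H : H ^t* = H ->
  exists M, forall x, enorm x = 1 -> enorm (H *m x) <= M.
Proof.
move=> hermH; have [M boundM] := bounded_numrange H; exists M.
apply: hermitian_enorm_le => // x /boundM; apply: le_trans.
by rewrite -lecR; exact: normc_ge_Re.
Qed.

Lemma opnorm_le_parts A : (0 < n)%N ->
  opnorm A <= opnorm (re_part A) + opnorm (im_part A).
Proof.
move=> n_gt0; apply: opnorm_le => // x x1.
have [Mr boundr] := bounded_hermitian _ (hermitian_re_part A).
have [Mi boundi] := bounded_hermitian _ (hermitian_im_part A).
rewrite [in enorm _](cartesian_parts A) mulmxDl -(scalemxAl 'i).
apply: le_trans (enormD _ _) _; rewrite enormZ.
rewrite (_ : cmod _ = 1); last by apply: complexI; rewrite -normc_cmod normCi.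
rewrite mul1r; apply: lerD; first exact: enorm_le_opnorm boundr x1.
exact: enorm_le_opnorm boundi x1.
Qed.

End InnerProduct.

(** * The sector condition and the final estimate *)

Lemma ler_sin (R : realType) :
  {in `[(- (pi / 2)), pi / 2] &, {mono (@sin R) : x y / x <= y}}.
Proof. by apply: le_mono_in => x y xI yI; rewrite ltr_sin. Qed.

Theorem theorem3p5 (R : realType) (n : nat) (n_gt0 : (0 < n)%N)
  (theta1 theta2 : R)
  (theta1_range : 0 < theta1 < pi / 2) (theta2_range : 0 < theta2 < pi / 2)
  (A : 'M[R[i]]_n)
  (WA : numrange A `<=`
     [set z : R[i] | exists r theta : R,
        [/\ 0 < r, theta1 <= theta, theta <= theta2 &
            z = r%:C * cexpi (- theta)]]) :
  let gamma1 := Num.max theta2 (pi / 2 - theta1) in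
  numradius A >= csc gamma1 / 2 * opnorm A +
    csc gamma1 / 2 * `| opnorm (im_part A) - opnorm (re_part A) |.
Proof.
cbv zeta; set gamma1 := Num.max _ _; rewrite /csc.
have /andP[? ?] := theta1_range; have /andP[? ?] := theta2_range.
have gamma_bounds : theta2 <= gamma1 /\ pi / 2 - theta1 <= gamma1.
  by rewrite /gamma1 !le_max !lexx orbT.
have gamma_lt : gamma1 < pi / 2 by rewrite /gamma1 gt_max; apply/andP; split; lra.
case: gamma_bounds => le2 le1.
have sg : 0 < sin gamma1 by apply: sin_gt0_pihalf; apply/andP; split; lra.
(* Both bounds are monotonicity of sine up to [gamma1], which is below pi/2: theta <= theta2 <=
   [gamma1] for the sine, and cos theta = sin (pi/2 - theta) with pi/2 - theta <= pi/2 - theta1 <=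
   [gamma1] for the cosine. *)
have polar x : enorm x = 1 -> exists r theta : R,
    [/\ 0 < r <= numradius A, 0 <= cos theta <= sin gamma1,
     0 <= sin theta <= sin gamma1 &
     inner (A *m x) x = r%:C * cexpi (- theta)].
  move=> x1; have [r [theta [r0 t1 t2 zE]]] : 
    [set z : R[i] | exists r theta : R,
        [/\ 0 < r, theta1 <= theta, theta <= theta2 &
            z = r%:C * cexpi (- theta)]] (inner (A *m x) x).
    by apply: WA; exists x.
  exists r, theta; split=> //.
  (* Here r is the modulus of <Ax, x>. *)
  - rewrite r0 /=; apply: le_trans (cmod_inner_le_numradius _ _ _ _ x1).
    rewrite zE /cmod ComplexField.Normc.normcM /= cosN sinN sqrrN cos2Dsin2.
    by rewrite sqrtr1 mulr1 expr0n addr0 sqrtr_sqr ler_norm.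
  - rewrite cos_ge0_pihalf /=; last by apply/andP; split; lra.
    have -> : cos theta = sin (pi / 2 - theta).
      by rewrite -[in RHS]opprB sinN sinBpihalf opprK.
    by rewrite ler_sin ?in_itv /=; try (apply/andP; split); lra.
  - rewrite sin_ge0_pi /=; last by apply/andP; split; lra.
    by rewrite ler_sin ?in_itv /=; try (apply/andP; split); lra.
have re_le : opnorm (re_part A) <= numradius A * sin gamma1.
  apply: hermitian_opnorm_le (hermitian_re_part _ _ A) _ => // x /polar.
  move=> [r [t [/andP[r0 rw] /andP[c0 cg] _ zE]]].
  rewrite rinner_re_part zE; simpc => /=.
  rewrite cosN normrM !ger0_norm ?(ltW r0) //.
  by rewrite ler_pM // ltW.
have im_le : opnorm (im_part A) <= numradius A * sin gamma1.
  apply: hermitian_opnorm_le (hermitian_im_part _ _ A) _ => // x /polar.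
  move=> [r [t [/andP[r0 rw] _ /andP[c0 cg] zE]]].
  rewrite rinner_im_part zE; simpc => /=.
  (* The sector lies in the fourth quadrant, so the imaginary part is - r sin theta; the absolute
     value removes the sign. *)
  rewrite sinN mulrN normrN normrM !ger0_norm ?(ltW r0) //.
  by rewrite ler_pM // ltW.
move: (opnorm_le_parts _ _ A n_gt0) re_le im_le sg.
move: (opnorm A) (opnorm (re_part A)) (opnorm (im_part A)) (numradius A) (sin _) => a re im w s.
clear=> le_a le_re le_im s_gt0.
(* Clearing denominators leaves a + |im - re| <= 2 s w. As a <= re + im, the left side is at most 2
   re or 2 im, according to the sign of im - re. *)
rewrite -mulrDr -mulrA ler_pdivrMl // ler_pdivrMl //.
by case: (ler0P (im - re)) => _; lra.
Qed.
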